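(* Let $U_{\mathcal{P}}\subseteq U_{\mathcal{R}}$ be pattern groups in $U_n$, and let $$I=\{u\in U_{\mathcal{R}}\mid \text{for } i\neq j,\ u_{ij}\neq 0\text{ implies } i<j\text{ in }\mathcal{R}/\mathcal{P}\}.$$ If $(l-1)(u-1)=0$ for all $l\in I$ and $u\in U_{\mathcal{R}}$, then $$\mathrm{SInd}_{U_{\mathcal{P}}}^{U_{\mathcal{R}}}(\chi)=\mathrm{Ind}_{U_{\mathcal{P}}}^{U_{\mathcal{R}}}(\chi)\qquad\text{for all superclass functions }\chi\text{ of }U_{\mathcal{P}}.$$
   Context: $U_n$ is the group of $n\times n$ unipotent upper-triangular matrices over the finite field $\mathbb{F}_q$. For a partial order $\mathcal{P}$ on $\{1,\dots,n\}$, the pattern group is $$U_{\mathcal{P}}=\{u\in U_n\mid \text{for } i\neq j,\ u_{ij}\neq 0\text{ implies } i<j\text{ in }\mathcal{P}\}.$$ For two partial orders $\mathcal{P},\mathcal{R}$ on $\{1,\dots,n\}$, ''$i<j$ in $\mathcal{R}/\mathcal{P}$'' means that $i<j$ in $\mathcal{R}$ and $i\not< j$ in $\mathcal{P}$ (this relation need not be a partial order). For a pattern group $G$, two elements $u,v\in G$ are in the same superclass of $G$ if $v-1=x(u-1)y$ for some $x,y\in G$. A superclass function of $G$ is a function $G\to\mathbb{C}$ constant on superclasses of $G$. For pattern groups $H\subseteq G$ and a function $\chi:H\to\mathbb{C}$ let $\dot\chi:G\to\mathbb{C}$ be $\dot\chi(z)=\chi(z)$ if $z\in H$ and $\dot\chi(z)=0$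 if $z\notin H$. For a superclass function $\chi$ of $H$, superinduction is $$\mathrm{SInd}_H^G(\chi)(g)=\frac{1}{|G||H|}\sum_{x,y\in G}\dot\chi\big(x(g-1)y+1\big),\qquad g\in G,$$ and induction is the usual one, $\mathrm{Ind}_H^G(\chi)(g)=\frac{1}{|H|}\sum_{y\in G}\dot\chi(y^{-1}gy)$. *)

(* Defs.v *)
From mathcomp Require Import all_boot all_order all_algebra.
From mathcomp Require Import complex reals.

Set Implicit Arguments.
Unset Strict Implicit.
Unset Printing Implicit Defensive.

Import GRing.Theory.
Local Open Scope ring_scope.

(* The index set {1, ..., n} is 'I_n, and a relation [P : rel 'I_n] is read
   as "i <= j in P".  P need not be compatible with the usual order of 'I_n. *)
Definition partial_order (n : nat) (P : rel 'I_n) : Prop :=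
  [/\ reflexive P, antisymmetric P & transitive P].

Definition lt_in (n : nat) (P : rel 'I_n) : rel 'I_n :=
  fun i j => (i != j) && P i j.

(* "i < j in R/P" *)
Definition lt_in_diff (n : nat) (R P : rel 'I_n) : rel 'I_n :=
  fun i j => lt_in R i j && ~~ lt_in P i j.

Definition offdiag_supported (F : finFieldType) (n : nat) (S : rel 'I_n)
    (u : 'M[F]_n) : bool :=
  [forall i, forall j, (i != j) && (u i j != 0) ==> S i j].

(* [is_trig_mx] means lower triangular, hence the transpose. *)
Definition unitriangular (F : finFieldType) (n : nat) : {set 'M[F]_n} :=
  [set u | is_trig_mx u^T & [forall i, u i i == 1]].

Definition pattern_group (F : finFieldType) (n : nat) (P : rel 'I_n) :
    {set 'M[F]_n} :=
  [set u in unitriangular F n | offdiag_supported (lt_in P) u].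

(* This set need not be a group, since "i < j in R/P" need not be transitive. *)
Definition complement_pattern (F : finFieldType) (n : nat) (R P : rel 'I_n) :
    {set 'M[F]_n} :=
  [set u in pattern_group F R | offdiag_supported (lt_in_diff R P) u].

Definition same_superclass (F : finFieldType) (n : nat) (G : {set 'M[F]_n})
    (u v : 'M[F]_n) : Prop :=
  exists x y, [/\ x \in G, y \in G
    & v - 1%:M = x *m (u - 1%:M) *m y].

(* A function G -> C is represented by a function on all n x n matrices whose
   values outside G are irrelevant. *)
Definition superclass_function (F : finFieldType) (n : nat) (K : realType)
    (G : {set 'M[F]_n}) (chi : 'M[F]_n -> K[i]) : Prop :=
  {in G &, forall u v, same_superclass G u v -> chi u = chi v}.

Definition extend0 (F : finFieldType) (n : nat) (K : realType)
    (H : {set 'M[F]_n}) (chi : 'M[F]_n -> K[i]) : 'M[F]_n -> K[i] :=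
  fun z => if z \in H then chi z else 0.

Definition SInd (F : finFieldType) (n : nat) (K : realType)
    (H G : {set 'M[F]_n}) (chi : 'M[F]_n -> K[i]) (g : 'M[F]_n) : K[i] :=
  (#|G|%:R * #|H|%:R)^-1 *
    \sum_(x in G) \sum_(y in G)
      extend0 H chi (x *m (g - 1%:M) *m y + 1%:M).

(* [invmx y] is the true inverse: the elements of a pattern group G are
   unitriangular, hence invertible. *)
Definition Ind (F : finFieldType) (n : nat) (K : realType)
    (H G : {set 'M[F]_n}) (chi : 'M[F]_n -> K[i]) (g : 'M[F]_n) : K[i] :=
  #|H|%:R^-1 * \sum_(y in G) extend0 H chi (invmx y *m g *m y).

(* Main.v *)
(* Write x in U_R as 1 + a + b, with a supported on the relations of P and b on
   those of R/P.  Then 1 + b is in I, so b (g - 1) = 0 and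
   x (g - 1) = (1 + a) (g - 1) with 1 + a in U_P.  Hence the left factor x in
   SInd, and the left factor y^-1 in Ind, act through U_P, where the superclass
   function does not see them: both reduce to
   (1 / |U_P|) \sum_y chi ((g - 1) y + 1). *)
Require Import Defs.
From mathcomp Require Import all_boot all_order all_algebra.
From mathcomp Require Import complex reals.

Import GRing.Theory Num.Theory.
Local Open Scope ring_scope.

Section PatternGroups.
Variables (F : finFieldType) (n : nat).
Implicit Types (S P R : rel 'I_n) (u v x h m g : 'M[F]_n).

(** Passing to [u - 1] merges triangularity, unit diagonal and support into one condition on nonzero
    entries: the diagonal is covered because [i < i] fails. *)
Lemma unitriangular_supportedP S u :
  reflect (forall i j, (u - 1%:M) i j != 0 -> (i < j)%N && S i j)
          ((u \in unitriangular F n) && offdiag_supported S u).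
Proof.
apply: (iffP andP) => [[]|uS].
  rewrite inE => /andP[/is_trig_mxP utrig /forallP u1].
  move=> /forallP uS i j; rewrite !mxE.
  have [<-|neq_ij] := eqVneq i j; first by rewrite (eqP (u1 i)) subrr eqxx.
  rewrite subr0 => nz_uij.
  have /forallP/(_ j) := uS i; rewrite neq_ij nz_uij /= => ->; rewrite andbT.
  have [//|le_ji] := ltnP i j.
  have lt_ji : (j < i)%N by rewrite ltn_neqAle eq_sym neq_ij.
  by move: (utrig j i lt_ji) nz_uij; rewrite mxE => ->; rewrite eqxx.
split.
  rewrite inE; apply/andP; split.
    apply/is_trig_mxP => i j lt_ij; rewrite mxE.
    apply: contraTeq lt_ij => nz_uji.
    have [-> |neq_ij] := eqVneq i j; first by rewrite ltnn.
    have /andP[lt_ji _] : (j < i)%N && S j i.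
      by apply: uS; rewrite !mxE [j == i]eq_sym (negPf neq_ij) subr0.
    by rewrite -leqNgt ltnW.
  apply/forallP => i; rewrite -subr_eq0.
  by apply/negPn/negP => nz; have := uS i i; rewrite !mxE eqxx ltnn nz => /(_ isT).
apply/forallP => i; apply/forallP => j; apply/implyP => /andP[neq_ij nz_uij].
have /andP[] // : (i < j)%N && S i j.
by apply: uS; rewrite !mxE (negPf neq_ij) subr0.
Qed.

Lemma pattern_groupP P u :
  reflect (forall i j, (u - 1%:M) i j != 0 -> (i < j)%N && lt_in P i j)
          (u \in pattern_group F P).
Proof. rewrite inE; exact: unitriangular_supportedP. Qed.

Lemma pattern_group1 P : 1%:M \in pattern_group F P.
Proof. by apply/pattern_groupP => i j; rewrite subrr mxE eqxx. Qed.

(** Write hm = m + (h - 1)m: a nonzero term of the second product gives i < k < j in P, so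
    transitivity preserves the support. The shifted form, with [m] playing u - 1, matches the way
    superclasses act. *)
Lemma pattern_group_mulS P h m : transitive P -> h \in pattern_group F P ->
  m + 1%:M \in pattern_group F P -> h *m m + 1%:M \in pattern_group F P.
Proof.
move=> trP /pattern_groupP hP /pattern_groupP mP.
apply/pattern_groupP => i j; rewrite addrK; rewrite addrK in mP.
have -> : h *m m = m + (h - 1%:M) *m m by rewrite mulmxBl mul1mx addrC subrK.
apply: contraR => nPij; rewrite mxE.
have -> : m i j = 0 by apply: contraNeq nPij; exact: mP.
rewrite add0r mxE big1 // => k _.
have [->|nz_hik] := eqVneq ((h - 1%:M) i k) 0; first by rewrite mul0r.
have [->|nz_mkj] := eqVneq (m k j) 0; first by rewrite mulr0.
have /andP[lt_ik /andP[_ Pik]] := hP _ _ nz_hik.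
have /andP[lt_kj /andP[_ Pkj]] := mP _ _ nz_mkj.
have lt_ij := ltn_trans lt_ik lt_kj.
case/negP: nPij; rewrite /lt_in lt_ij (trP k) //= andbT.
(* The strictness [i != j] comes from the numerical order of the indices. *)
by apply: contraTneq lt_ij => ->; rewrite ltnn.
Qed.

Lemma pattern_group_mul P u v : transitive P -> u \in pattern_group F P ->
  v \in pattern_group F P -> u *m v \in pattern_group F P.
Proof.
move=> trP uP vP.
have -> : u *m v = u *m (v - 1%:M) + (u - 1%:M) + 1%:M.
  by rewrite mulmxBr mulmx1 addrA !subrK.
have := @pattern_group_mulS P u (v - 1%:M) trP uP.
rewrite subrK => /(_ vP) /pattern_groupP wP.
move/pattern_groupP: uP => uP.
apply/pattern_groupP => i j; rewrite addrK; rewrite addrK in wP.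
apply: contraR => nPij; rewrite mxE.
have -> : (u *m (v - 1%:M)) i j = 0 by apply: contraNeq nPij; exact: wP.
by rewrite add0r; apply: contraR nPij; exact: uP.
Qed.

Lemma pattern_group_unit P u : u \in pattern_group F P -> u \in unitmx.
Proof.
rewrite 2!inE => /andP[/andP[utrig /forallP u1] _].
rewrite -unitmx_tr unitmxE det_trig // big1 ?unitr1 // => i _.
by rewrite mxE (eqP (u1 i)).
Qed.

(** Left multiplication by [u] is an injection of a finite set into itself, hence onto, so it
    attains the identity. *)
Lemma pattern_group_inv P u : transitive P -> u \in pattern_group F P ->
  invmx u \in pattern_group F P.
Proof.
move=> trP uP; have uU := pattern_group_unit P u uP.
have uinj : injective (mulmx u : 'M[F]_n -> 'M[F]_n) := can_inj (mulKmx uU).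
have : mulmx u @: pattern_group F P == pattern_group F P.
  rewrite eqEcard card_imset // leqnn andbT.
  by apply/subsetP => _ /imsetP[v vP ->]; exact: pattern_group_mul.
move/eqP/setP/(_ 1%:M); rewrite pattern_group1 => /imsetP[v vP uv1].
by rewrite -[invmx u]mulmx1 uv1 mulKmx.
Qed.

Lemma pattern_group_mulSE P h m : transitive P -> h \in pattern_group F P ->
  (h *m m + 1%:M \in pattern_group F P) = (m + 1%:M \in pattern_group F P).
Proof.
move=> trP hP; apply/idP/idP => [hmP|]; last exact: pattern_group_mulS.
rewrite -(mulKmx (pattern_group_unit P h hP) m).
by apply: pattern_group_mulS => //; exact: pattern_group_inv.
Qed.

Lemma pattern_group_factor P R x g :
  (forall l u, l \in complement_pattern F R P -> u \in pattern_group F R ->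
     (l - 1%:M) *m (u - 1%:M) = 0) ->
  x \in pattern_group F R -> g \in pattern_group F R ->
  exists2 h, h \in pattern_group F P
           & x *m (g - 1%:M) = h *m (g - 1%:M).
Proof.
move=> hI /pattern_groupP xR gR.
(* The splitting of x - 1 is additive: [h] is 1 + a and [l] is 1 + b, so [l - 1] equals [x - h], and
   the hypothesis applied to [l] and [g] gives (x - h)(g - 1) = 0. *)
pose h : 'M[F]_n :=
  \matrix_(i, j) (if lt_in P i j then (x - 1%:M) i j else 0) + 1%:M.
pose l := x - h + 1%:M.
have lE i j : (l - 1%:M) i j = if lt_in P i j then 0 else (x - 1%:M) i j.
  rewrite /l addrK /h opprD addrCA addrC !mxE.
  by case: ifP => _; rewrite ?subrr ?subr0 // addrAC subrr add0r.
exists h.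
  apply/pattern_groupP => i j; rewrite addrK mxE.
  case: ifP => [_ /xR/andP[-> _] //|_]; by rewrite eqxx.
have lI : l \in complement_pattern F R P.
  have lS : forall i j, (l - 1%:M) i j != 0 -> (i < j)%N && lt_in_diff R P i j.
    move=> i j; rewrite lE /lt_in_diff; case: ifP => [_|_ /xR]; first by rewrite eqxx.
    by rewrite andbT.
  rewrite inE; apply/andP; split.
    by apply/pattern_groupP => i j /lS /and3P[-> ->].
  by have /andP[] := introT (unitriangular_supportedP _ l) lS.
have := hI l g lI gR; rewrite addrK mulmxBl => /eqP.
by rewrite subr_eq0 => /eqP.
Qed.

(** Both arguments lie in U_P or neither does; inside U_P they share a superclass, witnessed by [h]
    on the left and 1 on the right. *)
Lemma extend0_mulS (K : realType) P (chi : 'M[F]_n -> K[i]) h m :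
  transitive P -> superclass_function (pattern_group F P) chi ->
  h \in pattern_group F P ->
  extend0 (pattern_group F P) chi (h *m m + 1%:M) =
  extend0 (pattern_group F P) chi (m + 1%:M).
Proof.
move=> trP chiS hP; rewrite /extend0 pattern_group_mulSE //.
case: ifP => // mP; apply/esym/chiS => //; first by rewrite pattern_group_mulSE.
by exists h, 1%:M; rewrite !addrK mulmx1 pattern_group1.
Qed.

End PatternGroups.

Theorem theorem3p3 (F : finFieldType) (n : nat) (K : realType)
    (P R : rel 'I_n) (hP : partial_order P) (hR : partial_order R)
    (hPR : pattern_group F P \subset pattern_group F R)
    (hI : forall l u : 'M[F]_n,
       l \in complement_pattern F R P -> u \in pattern_group F R ->
       (l - 1%:M) *m (u - 1%:M) = 0)
    (chi : 'M[F]_n -> K[i])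
    (hchi : superclass_function (pattern_group F P) chi)
    (g : 'M[F]_n) (hg : g \in pattern_group F R) :
  SInd (pattern_group F P) (pattern_group F R) chi g =
  Ind (pattern_group F P) (pattern_group F R) chi g.
Proof.
have [_ _ trP] := hP; have [_ _ trR] := hR.
(* Only [x] is constrained here. This serves SInd with an arbitrary [x] of U_R, and Ind with
   [invmx y] in its place. *)
have dropl x y : x \in pattern_group F R ->
    extend0 (pattern_group F P) chi (x *m (g - 1%:M) *m y + 1%:M) =
    extend0 (pattern_group F P) chi ((g - 1%:M) *m y + 1%:M).
  move=> xR; have [h hH ->] := pattern_group_factor F n P R x g hI xR hg.
  by rewrite -mulmxA; exact: extend0_mulS.
rewrite /SInd /Ind.
under eq_bigr => x xR do under eq_bigr => y _ do rewrite dropl //.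
(* The summand no longer depends on [x], so the outer sum contributes a factor |U_R|, which cancels
   against the normalization. *)
rewrite sumr_const -[X in _ * X]mulr_natl invfM mulrACA -mulrA.
rewrite mulKf; last first.
  by rewrite pnatr_eq0 -lt0n; apply/card_gt0P; exists 1%:M; exact: pattern_group1.
congr (_ * _); apply: eq_bigr => y yR.
(* Used backwards, [dropl] inserts y^-1 on the left, and y^-1 (g - 1) y + 1 = y^-1 g y. *)
rewrite -(dropl (invmx y)); last exact: pattern_group_inv.
by rewrite mulmxBr mulmxBl mulmx1 mulVmx ?subrK // (pattern_group_unit F n R).
Qed.
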